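(* Let $D=(V(D),E(D),w)$ be a weighted oriented graph without isolated vertices, in which every source and every sink has weight $1$, and suppose that its underlying graph $G$ has no $3$-cycles, no $5$-cycles and no $7$-cycles. Then $I(D)$ is unmixed if and only if both of the following conditions hold: (1) $G$ has a perfect matching $P$ with property (P); (2) (for this same $P$) if $a\in V(D)$, $w(a)>1$, $b'\in N_D^+(a)$ and $\{b,b'\}\in P$, then $N_D(b)\subset N_D^+(a)$.
   Context: All graphs are finite and simple. A weighted oriented graph $D=(V(D),E(D),w)$ with underlying simple graph $G$ consists of $V(D)=V(G)$, a set $E(D)\subset V(D)\times V(D)$ with $E(G)=\{\{x,y\}: (x,y)\in E(D)\}$ and $|E(D)|=|E(G)|$ (each edge of $G$ gets exactly one direction), and a weight function $w:V(D)\to\mathbb{N}_+=\{1,2,\dots\}$. A source is a vertex with only outgoing edges; a sink is a vertex with only incoming edges. Standing convention: sources and sinks have weight $1$. For a vertex $x$: $N_D^+(x)=\{y:(x,y)\in E(D)\}$, $N_D^-(x)=\{y:(y,x)\in E(D)\}$, $N_D(x)=N_D^+(x)\cup N_D^-(x)$. If $V(D)=\{x_1,\dots,x_n\}$, view the vertices as variables of $R=K[x_1,\dots,x_n]$, $K$ a field. The edge ideal of $D$ is $I(D)=(x_ix_j^{w(x_j)} : (x_i,x_j)\in E(D))\subset R$. An ideal is unmixed if all its associated primes have the same height. A matching is a set of pairwise disjoint edges; it is perfect if it covers all vertices. A perfect matching $P$ of $G$ has property (P) if $\{a,a'\}\in E(G)$ whenever $\{a,b\},\{a',b'\}\in E(G)$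 and $\{b,b'\}\in P$. Here $a$ and $a'$ are not assumed distinct; since $G$ has no loops, property (P) in particular implies that no vertex is adjacent to both endpoints of an edge of $P$. Cycles are subgraphs, not necessarily induced. *)

(* Defs.v *)
From HB Require Import structures.
From mathcomp Require Export all_boot all_algebra.
From mathcomp Require Export boolp.
From mathcomp Require Export mpoly.

Set Implicit Arguments.
Unset Strict Implicit.
Unset Printing Implicit Defensive.

Import GRing.Theory.
Local Open Scope ring_scope.

(* Ideals are boolean predicates, as in ring_quotient; with the classical
   reflection of boolp these are arbitrary subsets of the ring. *)

Section Ideals.
Context {R : comNzRingType}.
Implicit Types I P Q : {pred R}.

Definition ideal_gen (J : finType) (A : {pred J}) (g : J -> R) : {pred R} :=
  [pred f | `[< exists c : J -> R, f = \sum_(j in A) c j * g j >]].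

(* [idealr_closed] includes 1 \notin P. *)
Definition prime_ideal P : Prop := idealr_closed P /\ prime_idealr_closed P.

(* P = (I : f) for some f, and P is prime. *)
Definition associated_prime I P : Prop :=
  prime_ideal P /\ exists f : R, forall g : R, (g \in P) = (g * f \in I).

Definition strict_subideal P Q : Prop :=
  {subset P <= Q} /\ ~ {subset Q <= P}.

(* c 0 < c 1 < ... < c h = P; the values of c beyond h are irrelevant. *)
Definition prime_chain (c : nat -> {pred R}) (h : nat) P : Prop :=
  [/\ forall i, (i <= h)%N -> prime_ideal (c i),
      forall i, (i < h)%N -> strict_subideal (c i) (c i.+1)
    & c h =i P].

Definition has_height P (h : nat) : Prop :=
  (exists c, prime_chain c h P) /\
  (forall c k, prime_chain c k P -> (k <= h)%N).

(* Equality of heights in nat extended with infinity. *)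
Definition same_height P Q : Prop :=
  forall h : nat, has_height P h <-> has_height Q h.

Definition unmixed I : Prop :=
  forall P Q, associated_prime I P -> associated_prime I Q -> same_height P Q.

End Ideals.

(* Asymmetry of [arc] excludes loops and gives every edge of the underlying
   graph exactly one direction. *)
Record wograph (n : nat) := WOGraph {
  arc : rel 'I_n;
  weight : 'I_n -> nat;
  arc_asym : forall x y, arc x y -> ~~ arc y x;
  weight_gt0 : forall x, (0 < weight x)%N
}.

Section Graphs.
Variables (n : nat) (D : wograph n).
Implicit Types (x y a b : 'I_n) (P : {set {set 'I_n}}).

Definition edges : {set {set 'I_n}} :=
  [set [set e.1; e.2] | e : 'I_n * 'I_n & arc D e.1 e.2].

Definition adj : rel 'I_n := [rel x y | [set x; y] \in edges].

Definition out_nbhd x : {set 'I_n} := [set y | arc D x y].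
Definition in_nbhd x : {set 'I_n} := [set y | arc D y x].
Definition nbhd x : {set 'I_n} := out_nbhd x :|: in_nbhd x.

Definition isolated x : bool := nbhd x == set0.

(* An isolated vertex counts as both a source and a sink. *)
Definition source x : bool := in_nbhd x == set0.
Definition sink x : bool := out_nbhd x == set0.

(* Not necessarily induced; only meaningful for 3 <= k. *)
Definition has_cycle (k : nat) : Prop :=
  exists c : seq 'I_n, size c = k /\ ucycle adj c.

Definition perfect_matching P : Prop :=
  [/\ P \subset edges, trivIset P & cover P = [set: 'I_n]].

Definition property_P P : Prop :=
  forall a a' b b' : 'I_n,
    [set a; b] \in edges -> [set a'; b'] \in edges -> [set b; b'] \in P ->
    [set a; a'] \in edges.

Definition edge_ideal (K : fieldType) : {pred {mpoly K[n]}} :=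
  ideal_gen [pred e : 'I_n * 'I_n | arc D e.1 e.2]
            (fun e => 'X_(e.1) * 'X_(e.2) ^+ weight D e.2).

End Graphs.

Arguments edge_ideal {n} D K _.

(* Main.v *)
Require Import Defs.

(** A monomial lies outside [I(D)] iff no arc leads from its support to a vertex
    where its exponent reaches the weight; hence the prime generated by a vertex
    cover [C] is associated to [I(D)] as soon as [C] is strong.  Since [K[x_1,...,x_n]] has dimension at most [n] (any [n + 1]
    polynomials are algebraically dependent), this prime has height [#|C|], and
    unmixedness bears on the sizes of strong covers.

    If [I(D)] is unmixed, all maximal independent sets have the same size.  Take
    [y] of minimal degree and let [Y] be the set of vertices with the same
    neighbourhood.  For each other vertex [u] at distance two from [y] choose a
    neighbour outside [N(y)]; without closed walks of length 3, 5 and 7 the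
    chosen vertices form an independent set that isolates the complete bipartite
    graph on [Y] and [N(y)], whence [#|Y| = #|N(y)|].  Matching [Y] with [N(y)]
    and removing both leaves a smaller graph of the same kind.  A violation of
    (2) yields a strong cover containing both ends of a matching edge, hence one
    that is too large.

    Conversely, under (1) and (2) every monomial outside [I(D)] lies outside one
    of the irreducible monomial ideals attached to the maximal independent sets,
    so [I(D)] is the intersection of these ideals and its associated primes are
    among their radicals. *)

Set Implicit Arguments.
Unset Strict Implicit.
Unset Printing Implicit Defensive.

(** * Independent sets inside a set of vertices *)

Section IndependentSets.
Variables (T : finType) (e : rel T).
Hypothesis e_sym : ssrbool.symmetric e.
Implicit Types (S W : {set T}) (x y : T).

Definition independent S := [forall x in S, forall y in S, ~~ e x y].

Definition maximal_independent W :=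
  maxset (fun S => (S \subset W) && independent S).

Lemma independentP S :
  reflect {in S &, forall x y, ~~ e x y} (independent S).
Proof.
apply: (iffP forall_inP) => [h x y xS yS|h x xS].
  exact: (forall_inP (h x xS)).
by apply/forall_inP => y yS; apply: h.
Qed.

Lemma independentS S1 S2 : S1 \subset S2 -> independent S2 -> independent S1.
Proof.
move=> /subsetP sub /independentP h; apply/independentP => x y xS yS.
by apply: h; apply: sub.
Qed.

Lemma independentU S1 S2 :
  independent S1 -> independent S2 ->
  {in S1 & S2, forall x y, ~~ e x y} -> independent (S1 :|: S2).
Proof.
move=> /independentP h1 /independentP h2 h; apply/independentP => x y.
rewrite !inE => /orP[xS|xS] /orP[yS|yS].
- exact: h1.
- exact: h.
- by rewrite e_sym; apply: h.
- exact: h2.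
Qed.

(** The proviso [~~ e x x] is there because [e] may have loops: a looped vertex can never be added
    to an independent set. *)
Lemma maximal_independentP W S :
  reflect [/\ S \subset W, independent S &
            forall x, x \in W -> x \notin S -> ~~ e x x ->
              exists2 y, y \in S & e x y]
          (maximal_independent W S).
Proof.
apply: (iffP maxsetP) => [[/andP[SW iS] Smax]|[SW iS Smax]].
  split=> // x xW xS exx; apply/exists_inP; rewrite -[X in is_true X]negbK.
  rewrite negb_exists_in; apply/negP => /forall_inP nxS.
  have /Smax : (x |: S \subset W) && independent (x |: S).
    rewrite subUset sub1set xW SW /=; apply: independentU => //.
      by apply/independentP => y z /set1P -> /set1P ->.
    by move=> y z /set1P ->; apply: nxS.
  by move=> /(_ (subsetUr _ _)) eqS; rewrite -eqS setU11 in xS.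
split; first by rewrite SW.
move=> B /andP[BW /independentP iB] SB; apply/eqP; rewrite eqEsubset SB andbT.
apply/subsetP => x xB; apply/negPn/negP => xS.
have [y yS exy] := Smax x (subsetP BW x xB) xS (iB x x xB xB).
by have := iB x y xB (subsetP SB y yS); rewrite exy.
Qed.

Lemma maximal_independent_exists W S :
  S \subset W -> independent S ->
  exists2 M, maximal_independent W M & S \subset M.
Proof.
move=> SW iS.
have [|M Mmax SM] := @maxset_exists _ (fun S => (S \subset W) && independent S) S.
  by rewrite SW.
by exists M.
Qed.

Definition well_covered W : Prop :=
  forall S1 S2, maximal_independent W S1 -> maximal_independent W S2 ->
    #|S1| = #|S2|.

End IndependentSets.

(** * From short odd cycles to short odd closed walks *)

Section OddClosedWalks.
Variables (T : finType) (e : rel T).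
Hypothesis e_sym : ssrbool.symmetric e.
Hypothesis e_irr : irreflexive e.
Hypothesis cycle3 : forall c : seq T, size c = 3 -> ~ ucycle e c.
Hypothesis cycle5 : forall c : seq T, size c = 5 -> ~ ucycle e c.
Hypothesis cycle7 : forall c : seq T, size c = 7 -> ~ ucycle e c.

Lemma no_closed_walk3 a b c : e a b -> e b c -> e c a -> False.
Proof.
move=> ab bc ca; apply: (cycle3 (c := [:: a; b; c])) => //.
rewrite /ucycle /= ab bc ca /= !inE !negb_or !andbT.
have neq u v : e u v -> u != v.
  by move=> uv; apply/eqP => equv; rewrite equv e_irr in uv.
by rewrite !neq // e_sym.
Qed.

(** Nonconsecutive vertices are joined by three successive steps of the walk, so a coincidence would
    close a walk of length 3. *)
Lemma no_closed_walk5 a b c d f :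
  e a b -> e b c -> e c d -> e d f -> e f a -> False.
Proof.
move=> ab bc cd df fa; apply: (cycle5 (c := [:: a; b; c; d; f])) => //.
have neq u v : e u v -> u != v.
  by move=> uv; apply/eqP => equv; rewrite equv e_irr in uv.
have neq2 u v w z : e u z -> e z w -> e w v -> u != v.
  move=> uz zw wv; apply/eqP => equv; rewrite -equv in wv.
  exact: no_closed_walk3 uz zw wv.
rewrite /ucycle /= ab bc cd df fa /= !inE !negb_or !andbT.
rewrite (neq _ _ ab) (neq _ _ bc) (neq _ _ cd) (neq _ _ df) /=.
rewrite [a == f]eq_sym (neq _ _ fa) andbT /=.
rewrite [a == c]eq_sym [b == d]eq_sym [c == f]eq_sym.
rewrite (neq2 _ _ _ _ cd df fa) (neq2 _ _ _ _ df fa ab) (neq2 _ _ _ _ fa ab bc).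
by rewrite (neq2 _ _ _ _ ab bc cd) (neq2 _ _ _ _ bc cd df).
Qed.

(** Nonconsecutive vertices are joined by three or by five successive steps; a coincidence would
    close an odd walk that is already excluded. *)
Lemma no_closed_walk7 a b c d f g h :
  e a b -> e b c -> e c d -> e d f -> e f g -> e g h -> e h a -> False.
Proof.
move=> ab bc cd df fg gh ha.
apply: (cycle7 (c := [:: a; b; c; d; f; g; h])) => //.
have neq u v : e u v -> u != v.
  by move=> uv; apply/eqP => equv; rewrite equv e_irr in uv.
have neq3 u v w z : e u z -> e z w -> e w v -> u != v.
  move=> uz zw wv; apply/eqP => equv; rewrite -equv in wv.
  exact: no_closed_walk3 uz zw wv.
have neq5 u v w z s t : e u z -> e z w -> e w s -> e s t -> e t v -> u != v.
  move=> uz zw ws st tv; apply/eqP => equv; rewrite -equv in tv.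
  exact: no_closed_walk5 uz zw ws st tv.
have ac : a != c by rewrite eq_sym (neq5 _ _ _ _ _ _ cd df fg gh ha).
have bd : b != d by rewrite eq_sym (neq5 _ _ _ _ _ _ df fg gh ha ab).
have cf : c != f by rewrite eq_sym (neq5 _ _ _ _ _ _ fg gh ha ab bc).
have dg : d != g by rewrite eq_sym (neq5 _ _ _ _ _ _ gh ha ab bc cd).
have fh : f != h by rewrite eq_sym (neq5 _ _ _ _ _ _ ha ab bc cd df).
have ag : a != g by rewrite (neq5 _ _ _ _ _ _ ab bc cd df fg).
have bh : b != h by rewrite (neq5 _ _ _ _ _ _ bc cd df fg gh).
rewrite /ucycle /= ab bc cd df fg gh ha /= !inE !negb_or !andbT.
rewrite ac bd cf dg fh ag bh (neq _ _ ab) (neq _ _ bc) (neq _ _ cd).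
rewrite (neq _ _ df) (neq _ _ fg) (neq _ _ gh) (eq_sym a h) (neq _ _ ha).
rewrite (neq3 _ _ _ _ ab bc cd) (neq3 _ _ _ _ bc cd df).
rewrite (neq3 _ _ _ _ cd df fg) (neq3 _ _ _ _ df fg gh).
rewrite (eq_sym a f) (eq_sym b g) (eq_sym c h).
by rewrite (neq3 _ _ _ _ fg gh ha) (neq3 _ _ _ _ gh ha ab) (neq3 _ _ _ _ ha ab bc).
Qed.

End OddClosedWalks.

(** * Perfect matchings of well-covered graphs without short odd closed walks *)

Section WellCoveredMatching.
Variables (T : finType) (e : rel T).
Hypothesis e_sym : ssrbool.symmetric e.
Hypothesis walk3 : forall a b c, e a b -> e b c -> e c a -> False.
Hypothesis walk5 :
  forall a b c d f, e a b -> e b c -> e c d -> e d f -> e f a -> False.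
Hypothesis walk7 : forall a b c d f g h,
  e a b -> e b c -> e c d -> e d f -> e f g -> e g h -> e h a -> False.
Implicit Types (S W : {set T}) (x y z : T).

Definition nbhd_in W x := [set z in W | e x z].

Let e_irr x : e x x = false.
Proof. by apply/negP => exx; apply: (walk3 exx exx exx). Qed.

Lemma indep_nbhd_in W y : independent e (nbhd_in W y).
Proof.
apply/independentP => u v; rewrite !inE => /andP[_ yu] /andP[_ yv].
by apply/negP => uv; rewrite e_sym in yv; apply: (walk3 yu uv yv).
Qed.

Definition twins W y := [set u in W | nbhd_in W u == nbhd_in W y].

Lemma twins_adj W y u z : u \in twins W y -> z \in nbhd_in W y -> e u z.
Proof.
by rewrite inE => /andP[_ /eqP <-]; rewrite inE => /andP[].
Qed.

Lemma adj_twins W y u z :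
  u \in twins W y -> z \in W -> e u z -> z \in nbhd_in W y.
Proof. by rewrite inE => /andP[_ /eqP <-] zW uz; rewrite inE zW. Qed.

Lemma indep_twins W y : independent e (twins W y).
Proof.
apply/independentP => u v uY vY; apply/negP => uv.
have vW : v \in W by move: vY; rewrite inE => /andP[].
have := twins_adj vY (adj_twins uY vW uv).
by rewrite e_irr.
Qed.

(* The set [S] picks, for every vertex [u] at distance two from [y] that is not
   a twin of [y], a neighbour of [u] outside [N(y)].  An edge inside [S] closes
   a walk of length 7, an edge from [S] to [N(y)] one of length 5. *)
Lemma isolating_set W y :
  y \in W -> (forall u, u \in W -> #|nbhd_in W y| <= #|nbhd_in W u|) ->
  exists S, [/\ S \subset W, independent e S,
    {in S & nbhd_in W y, forall s z, ~~ e s z},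
    {in S & twins W y, forall s z, ~~ e s z}
  & forall u z, u \in W -> z \in nbhd_in W y -> e u z -> u \notin twins W y ->
      exists2 s, s \in S & e u s].
Proof.
move=> yW ymin.
pose far u := [exists z in nbhd_in W y, e u z] && (u \in W :\: twins W y).
pose S := [set s in W :\: nbhd_in W y | [exists u, far u && e u s]].
have SW : S \subset W by apply/subsetP => s; rewrite !inE => /andP[/andP[]].
have Swalk s : s \in S -> exists z u, [/\ e y z, e z u & e u s].
  rewrite !inE => /andP[_ /existsP[u /andP[/andP[/exists_inP[z zy uz] _] us]]].
  by exists z, u; split=> //; [move: zy; rewrite inE => /andP[] | rewrite e_sym].
exists S; split=> //.
- apply/independentP => s t /Swalk[z [u [yz zu us]]] /Swalk[z' [u' [yz' zu' us']]].
  apply/negP => st; rewrite e_sym in us'; rewrite e_sym in zu'.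
  by rewrite e_sym in yz'; apply: (walk7 yz zu us st us' zu' yz').
- move=> s z /Swalk[z' [u [yz' zu us]]]; rewrite inE => /andP[_ yz].
  by apply/negP => sz; rewrite e_sym in yz; apply: (walk5 yz' zu us sz yz).
- move=> s z sS zY; apply/negP; rewrite e_sym => zs.
  have := adj_twins zY (subsetP SW s sS) zs.
  by apply/negP; move: sS; rewrite !inE => /andP[/andP[]].
move=> u z uW zZ uz uY.
(* Otherwise the minimal degree of [y] forces equality, and [u] is a twin. *)
have /subsetPn[s] : ~~ (nbhd_in W u \subset nbhd_in W y).
  apply/negP => sub; move: uY; rewrite inE uW /= eqEcard sub ymin //.
rewrite inE => /andP[sW us] sZ; exists s => //.
rewrite inE in_setD sZ sW /=; apply/existsP; exists u; rewrite us andbT.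
rewrite /far in_setD uW uY !andbT /=.
by apply/exists_inP; exists z.
Qed.

(** Two exchanges: [Z] is traded for [Y] in a maximal independent set containing [S] and [Z], and
    [Y] for [Z] in one containing [S] and [Y]. As all maximal independent sets have the same size,
    neither trade can gain vertices. *)
Lemma card_twins W y :
  well_covered e W -> y \in W -> nbhd_in W y != set0 ->
  (forall u, u \in W -> #|nbhd_in W y| <= #|nbhd_in W u|) ->
  #|twins W y| = #|nbhd_in W y|.
Proof.
move=> wc yW Z0 ymin; have [S [SW iS SZ SY Sdom]] := isolating_set yW ymin.
set Y := twins W y in SY Sdom *; set Z := nbhd_in W y in SZ Sdom Z0 *.
have YW : Y \subset W by apply/subsetP => u; rewrite inE => /andP[].
have ZW : Z \subset W by apply/subsetP => u; rewrite inE => /andP[].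
have disj (A : {set T}) M :
    independent e M -> A \subset M -> A != set0 ->
    forall B : {set T}, {in A & B, forall u z, e u z} -> [disjoint M & B].
  move=> /independentP iM AM /set0Pn[u uA] B AB; rewrite disjoint_subset.
  apply/subsetP => z zM; rewrite !inE; apply/negP => zB.
  by have := iM u z (subsetP AM u uA) zM; rewrite AB.
(* [(M \ A) u B] extends to a maximal independent set of the size of [M]. *)
have swap (A B : {set T}) M :
    maximal_independent e W M -> A \subset M -> [disjoint M & B] ->
    B \subset W -> independent e B ->
    {in M & B, forall m b, e m b -> m \in A} -> #|B| <= #|A|.
  move=> Mmax AM MB BW iB h.
  have [MW iM _] := maximal_independentP e_sym _ _ Mmax.
  have [||M' M'max sM'] := @maximal_independent_exists _ e W ((M :\: A) :|: B).
  - by rewrite subUset BW (subset_trans _ MW) // subsetDl.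
  - apply: independentU => //; first exact: independentS (subsetDl _ _) iM.
    move=> m b /setDP[mM mA] bB; apply/negP => mb.
    by rewrite (h m b) in mA.
  have := subset_leq_card sM'; rewrite (wc _ _ M'max Mmax).
  rewrite cardsU (_ : (M :\: A) :&: B = set0); last first.
    apply/setP => m; rewrite !inE; apply/negP => /andP[/andP[_ mM] mB].
    by have := disjointFr MB mM; rewrite mB.
  rewrite cards0 subn0 cardsD (setIidPr AM) -(leq_add2r #|A|) addnAC.
  by rewrite (subnK (subset_leq_card AM)) leq_add2l.
have yY : y \in Y by rewrite inE yW eqxx.
have Y0 : Y != set0 by apply/set0Pn; exists y.
apply/eqP; rewrite eqn_leq; apply/andP; split.
  have [||M Mmax SZM] := @maximal_independent_exists _ e W (S :|: Z).
  - by rewrite subUset SW.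
  - by apply: independentU => //; apply: indep_nbhd_in.
  have [MW iM _] := maximal_independentP e_sym _ _ Mmax.
  have ZM : Z \subset M by apply: subset_trans SZM; apply: subsetUr.
  apply: (swap Z Y M) => //; last 1 first.
  - move=> m b mM bY mb; apply: (adj_twins bY); last by rewrite e_sym.
    exact: (subsetP MW).
  - apply: (disj Z) => // z u zZ uY; rewrite e_sym; exact: twins_adj uY zZ.
  - exact: indep_twins.
have [||M Mmax SYM] := @maximal_independent_exists _ e W (S :|: Y).
- by rewrite subUset SW.
- by apply: independentU => //; apply: indep_twins.
have [MW iM _] := maximal_independentP e_sym _ _ Mmax.
have SM : S \subset M by apply: subset_trans SYM; apply: subsetUl.
have YM : Y \subset M by apply: subset_trans SYM; apply: subsetUr.
apply: (swap Y Z M) => //.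
- apply: (disj Y) => // u z; exact: twins_adj.
- exact: indep_nbhd_in.
(* A neighbour of [Z] outside [Y] has a neighbour in [S], hence in [M], so it cannot belong to
   [M]. *)
move=> m b mM bZ mb; apply/negPn/negP => mY.
have [s sS ms] := Sdom m b (subsetP MW m mM) bZ mb mY.
by have := independentP _ _ iM m s mM (subsetP SM s sS); rewrite ms.
Qed.

(** The matching is encoded as an involution along edges. The size clause serves later to derive
    property (P). *)
Lemma well_covered_matching W :
  well_covered e W -> (forall x, x \in W -> nbhd_in W x != set0) ->
  exists f : T -> T,
    (forall x, x \in W -> [/\ f x \in W, f (f x) = x & e x (f x)]) /\
    (forall S, maximal_independent e W S -> #|S|.*2 = #|W|).
Proof.
have [k] := ubnP #|W|; elim: k W => // k IHk W ltWk wc iso.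
have [W0|[y0 y0W]] := set_0Vmem W.
  exists id; split=> [x|S Smax]; first by rewrite W0 inE.
  have [SW _ _] := maximal_independentP e_sym _ _ Smax.
  by move: SW; rewrite W0 subset0 => /eqP->; rewrite cards0.
have [y] := @arg_minnP _ y0 (mem W) (fun u => #|nbhd_in W u|) y0W.
rewrite -[mem W y]/(y \in W) => yW ymin.
have cardYZ := card_twins wc yW (iso y yW) ymin.
set Y := twins W y in cardYZ; set Z := nbhd_in W y in cardYZ ymin.
have YW : Y \subset W by apply/subsetP => u; rewrite inE => /andP[].
have ZW : Z \subset W by apply/subsetP => u; rewrite inE => /andP[].
have YZadj : {in Y & Z, forall u z, e u z} by move=> u z; apply: twins_adj.
have disjYZ : [disjoint Y & Z].
  rewrite disjoint_subset; apply/subsetP => u uY; rewrite inE; apply/negP => uZ.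
  by have := YZadj u u uY uZ; rewrite e_irr.
have YnZ u : u \in Y -> u \in Z = false by apply: disjointFr disjYZ.
have yY : y \in Y by rewrite inE yW eqxx.
pose W' := W :\: (Y :|: Z).
have W'W : W' \subset W by apply: subsetDl.
have cardW : #|W| = (#|W'| + (#|Y| + #|Z|))%N.
  have YZW : Y :|: Z \subset W by rewrite subUset YW.
  have := cardsU Y Z; rewrite (eqP (_ : Y :&: Z == set0)) ?setI_eq0 //.
  rewrite cards0 subn0 => <-.
  by rewrite cardsD (setIidPr YZW) subnK // subset_leq_card.
have W'Y u z : u \in W' -> z \in Y -> ~~ e z u.
  move=> uW' zY; apply/negP => zu.
  have := adj_twins zY (subsetP W'W u uW') zu; apply/negP.
  by move: uW'; rewrite !inE negb_or => /andP[/andP[]].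
(* Adding [Y] preserves maximality, since [y] dominates [Z]; thus [W'] inherits well-coveredness,
   and sizes in [W] follow from those in [W']. *)
have extend S : maximal_independent e W' S ->
    maximal_independent e W (S :|: Y) /\ #|S :|: Y| = (#|S| + #|Y|)%N.
  move=> /(maximal_independentP e_sym)[SW' iS Smax]; split.
    apply/(maximal_independentP e_sym); split.
    - by rewrite subUset YW (subset_trans SW').
    - apply: independentU => //; first exact: indep_twins.
      by move=> s z sS zY; rewrite e_sym; apply: W'Y zY; apply: (subsetP SW').
    move=> x xW; rewrite in_setU negb_or => /andP[xS xY] exx.
    have [xZ|xZ] := boolP (x \in Z).
      by exists y; rewrite ?in_setU ?yY ?orbT // e_sym; apply: YZadj.
    have [|s sS xs] := Smax x _ xS exx; first by rewrite in_setD in_setU negb_or xY xZ.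
    by exists s; rewrite // in_setU sS.
  rewrite cardsU (eqP (_ : S :&: Y == set0)) ?cards0 ?subn0 //.
  rewrite setI_eq0 disjoint_subset; apply/subsetP => s /(subsetP SW').
  by rewrite !inE negb_or => /andP[/andP[]].
have [|||f2 [f2P f2card]] := IHk W'.
- rewrite -ltnS (leq_trans _ ltWk) // ltnS cardW -addn1 leq_add2l.
  by rewrite (leq_trans _ (leq_addr _ _)) // card_gt0; apply/set0Pn; exists y.
- move=> S1 S2 /extend[max1 c1] /extend[max2 c2].
  by apply/eqP; rewrite -(eqn_add2r #|Y|) -c1 -c2; apply/eqP; apply: wc.
- move=> u uW'; have uW := subsetP W'W u uW'.
  have [uYZ] : u \notin Y /\ u \notin Z.
    by move: uW'; rewrite !inE negb_or => /andP[/andP[]].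
  (* By minimality of the degree, [u] would otherwise be a twin. The neighbour [v] is not in [Y]
     either, since [u] would then lie in [Z]; so [u] is not isolated in [W']. *)
  have /subsetPn[v vu vZ] : ~~ (nbhd_in W u \subset Z).
    apply/negP => sub; case/negP: uYZ.
    by rewrite inE uW /= eqEcard sub ymin.
  move: vu; rewrite inE => /andP[vW uv].
  move=> uZ; apply/set0Pn; exists v; rewrite inE uv andbT.
  have vY : v \notin Y.
    by apply: contra uZ => vY; apply: (adj_twins vY uW); rewrite e_sym.
  by rewrite in_setD in_setU negb_or vY vZ vW.
(* Elements at the same position of the two enumerations are matched; for [x] in [A] and sets of
   equal size the default of [nth] is never reached. *)
pose g (A B : {set T}) x := nth x (enum B) (index x (enum A)).
have gP (A B : {set T}) x : #|A| = #|B| -> x \in A ->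
    g A B x \in B /\ g B A (g A B x) = x.
  move=> cAB xA; have ltx : index x (enum A) < size (enum B).
    by rewrite -cardE -cAB cardE index_mem mem_enum.
  have gB : g A B x \in B by rewrite -mem_enum mem_nth.
  split=> //; rewrite {1}/g {2}/g index_uniq ?enum_uniq //.
  by rewrite (set_nth_default x) ?nth_index ?mem_enum // index_mem mem_enum.
exists (fun x => if x \in Y then g Y Z x else if x \in Z then g Z Y x else f2 x).
split=> [x xW|S Smax]; last first.
  have [||S' S'max _] := @maximal_independent_exists _ e W' set0.
  - exact: sub0set.
  - by apply/independentP => u v; rewrite inE.
  have [max' c'] := extend _ S'max.
  by rewrite (wc _ _ Smax max') c' doubleD f2card // cardW -cardYZ addnn.
have [xY|xY] := boolP (x \in Y).
  have [gZ gK] := gP Y Z x cardYZ xY.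
  rewrite (disjointFl disjYZ gZ) gZ gK; split=> //; first exact: (subsetP ZW).
  exact: YZadj.
have [xZ|xZ] := boolP (x \in Z).
  have [gY gK] := gP Z Y x (esym cardYZ) xZ.
  rewrite gY gK; split=> //; first exact: (subsetP YW).
  by rewrite e_sym; apply: YZadj.
have [|f2W' f2K xf2] := f2P x; first by rewrite in_setD in_setU negb_or xY xZ.
have := f2W'; rewrite in_setD in_setU negb_or => /andP[/andP[/negPf-> /negPf->] f2W].
by split.
Qed.

End WellCoveredMatching.

Import GRing.Theory.
Local Open Scope ring_scope.

(** * Monomial ideals as sets of exponents *)

Section MonomialIdeals.
Variables (K : fieldType) (n : nat).
Implicit Types (U : pred 'X_{1..n}) (f g : {mpoly K[n]}) (m : 'X_{1..n}).

(** In general only a subspace; for [U] upward closed it is the monomial ideal with exponent set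
    [U]. *)
Definition mono_ideal U : {pred {mpoly K[n]}} := [pred f | all U (msupp f)].

Definition upward_closed U := forall m m', U m -> U (m + m')%MM.

Lemma mono_idealP U f :
  reflect (forall m, f@_m != 0 -> U m) (f \in mono_ideal U).
Proof.
by apply: (iffP allP) => h m; have := h m; rewrite mcoeff_msupp.
Qed.

Lemma mono_ideal0 U : 0 \in mono_ideal U.
Proof. by rewrite inE msupp0. Qed.

Lemma mono_idealD U f g :
  f \in mono_ideal U -> g \in mono_ideal U -> f + g \in mono_ideal U.
Proof.
move=> /mono_idealP fU /mono_idealP gU; apply/mono_idealP => m.
rewrite mcoeffD; have [->|/fU//] := eqVneq f@_m 0.
by rewrite add0r; apply: gU.
Qed.

Lemma mono_idealZ U (c : K) f : f \in mono_ideal U -> c *: f \in mono_ideal U.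
Proof.
move=> /mono_idealP fU; apply/mono_idealP => m.
by rewrite mcoeffZ mulf_eq0 negb_or => /andP[_]; apply: fU.
Qed.

Lemma mono_ideal_sum U (I : Type) (r : seq I) (P : pred I) F :
  (forall i, P i -> F i \in mono_ideal U) ->
  \sum_(i <- r | P i) F i \in mono_ideal U.
Proof.
move=> h; apply: (big_ind (fun f => f \in mono_ideal U)) => //.
- exact: mono_ideal0.
- exact: mono_idealD.
Qed.

Lemma mono_idealM U f g :
  upward_closed U -> g \in mono_ideal U -> f * g \in mono_ideal U.
Proof.
move=> upU /mono_idealP gU; apply/mono_idealP => m; rewrite -mcoeff_msupp.
move=> /msuppM_le /allpairsP[[m1 m2] /= [_ m2g ->]].
by rewrite addmC; apply: upU; apply: gU; rewrite -mcoeff_msupp.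
Qed.

Lemma mono_idealX U m : ('X_[m] \in mono_ideal U) = U m.
Proof. by rewrite inE msuppX /= andbT. Qed.

(** The colon by a monomial shifts the exponent set; annihilators of monomials modulo [I(D)] are
    computed this way. *)
Lemma mono_idealMX U f m :
  (f * 'X_[m] \in mono_ideal U) = (f \in mono_ideal (fun m' => U (m + m')%MM)).
Proof.
apply/mono_idealP/mono_idealP => h m'.
  by move=> fm'; apply: h; rewrite mcoeffMX.
rewrite -mcoeff_msupp (perm_mem (msuppMX _ _)) => /mapP[m1 m1f ->].
by apply: h; rewrite -mcoeff_msupp.
Qed.

Lemma eq_mono_ideal U1 U2 : U1 =1 U2 -> mono_ideal U1 =i mono_ideal U2.
Proof. by move=> eqU f; apply: eq_all. Qed.

Lemma ideal_gen_monomials (J : finType) (A : {pred J}) (g : J -> 'X_{1..n}) :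
  ideal_gen A (fun j => 'X_[g j] : {mpoly K[n]})
    =i mono_ideal (fun m => [exists j in A, (g j <= m)%MM]).
Proof.
set U : pred 'X_{1..n} := fun m => _.
have upU : upward_closed U.
  move=> m m' /exists_inP[j jA jm]; apply/exists_inP; exists j => //.
  by apply: lepm_trans jm _; apply: lem_addr.
move=> f; apply/asboolP/idP => [[c ->]|/mono_idealP fU].
  apply: mono_ideal_sum => j jA; apply: mono_idealM => //.
  by rewrite mono_idealX; apply/exists_inP; exists j => //; apply: lepm_refl.
(* Each monomial of [f] is charged to a single generator dividing it; the coefficient of a generator
   collects the quotients of its monomials. *)
have [j0 jP] : {s : 'X_{1..n} -> option J | forall m, U m ->
    exists2 j, s m = Some j & (j \in A) && (g j <= m)%MM}.
  exists (fun m => [pick j in A | (g j <= m)%MM]) => m /exists_inP[j jA jm].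
  by case: pickP => [j' ?|/(_ j)]; [exists j' | rewrite /= jA jm].
exists (fun j => \sum_(m <- msupp f | j0 m == Some j) f@_m *: 'X_[m - g j]).
under eq_bigr => j jA do rewrite big_distrl /=.
rewrite [LHS]mpolyE (exchange_big_dep predT) //=.
rewrite big_seq [RHS]big_seq; apply: eq_bigr => m; rewrite mcoeff_msupp => fm.
have [j jm /andP[jA jle]] := jP m (fU m fm).
rewrite (big_pred1 j) => [|j'].
  by rewrite -scalerAl -mpolyXD submK.
by rewrite jm /=; apply/andP/eqP => [[_ /eqP[->]]|->].
Qed.

End MonomialIdeals.

(** * Prime ideals generated by variables *)

Section VariableIdeals.
Variables (K : fieldType) (n : nat).
Implicit Types (C : {set 'I_n}) (f g : {mpoly K[n]}) (m : 'X_{1..n}).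

Definition meets C m := [exists i in C, (0 < m i)%N].

Definition var_ideal C : {pred {mpoly K[n]}} := mono_ideal (meets C).

Lemma meetsP C m : reflect (exists2 i, i \in C & (0 < m i)%N) (meets C m).
Proof. exact: exists_inP. Qed.

Lemma meets_up C : upward_closed (meets C).
Proof.
move=> m m' /meetsP[i iC mi]; apply/meetsP; exists i => //.
by rewrite mnmDE ltn_addr.
Qed.

(** The quotient map by [var_ideal C], realised inside the polynomial ring; its kernel is prime
    because that ring is a domain. *)
Definition kill C f := f \mPo [tuple if i \in C then 0 else 'X_i | i < n].

Lemma mcoeff_kill C f m : (kill C f)@_m = if meets C m then 0 else f@_m.
Proof.
have killX m' : kill C 'X_[m'] = if meets C m' then 0 else 'X_[m'].
  rewrite /kill comp_mpolyX; case: meetsP => [[i iC mi]|h].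
    by rewrite (bigD1 i) //= tnth_mktuple iC expr0n gtn_eqF ?mul0r.
  rewrite mpolyXE_id; apply: eq_bigr => i _; rewrite tnth_mktuple.
  case: ifPn => // iC; case: (posnP (m' i)) => [->|mi]; first by rewrite !expr0.
  by case: h; exists i.
rewrite /kill comp_mpolyEX raddf_sum /=.
under eq_bigr => m' _ do rewrite -/(kill C 'X_[m']) killX mcoeffZ.
case: ifPn => Cm.
  apply: big1 => m' _; case: ifPn => Cm'; first by rewrite mcoeff0 mulr0.
  by rewrite mcoeffX; case: eqP Cm' => [->|_ _]; rewrite ?Cm // mulr0.
rewrite [in RHS](mpolyE f) raddf_sum /=; apply: eq_bigr => m' _.
rewrite mcoeffZ; case: ifP => // Cm'.
by rewrite mcoeff0 mcoeffX; case: eqP Cm Cm' => [->|] => [/negP//|]; rewrite mulr0.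
Qed.

Lemma var_idealE C f : (f \in var_ideal C) = (kill C f == 0).
Proof.
apply/mono_idealP/eqP => [h|kf0 m fm].
  apply/mpolyP => m; rewrite mcoeff_kill mcoeff0; case: ifPn => // Cm.
  by apply/eqP; apply: contraNT Cm => /h.
have := mcoeff_kill C f m; rewrite kf0 mcoeff0.
by case: ifPn => // _ fm0; rewrite -fm0 eqxx in fm.
Qed.

Lemma kill_sub C f : f - kill C f \in var_ideal C.
Proof.
apply/mono_idealP => m; rewrite mcoeffB mcoeff_kill; case: ifP => // _.
by rewrite subrr eqxx.
Qed.

Lemma var_ideal_prime C : prime_ideal (var_ideal C).
Proof.
split; first split.
- exact: mono_ideal0.
- by rewrite var_idealE /kill comp_mpoly1 oner_eq0.
- move=> a u v uC vC; apply: mono_idealD => //.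
  by apply: mono_idealM => //; apply: meets_up.
move=> u v; rewrite !var_idealE /kill rmorphM /= mulf_eq0 //.
Qed.

Lemma var_idealX C i : ('X_i \in var_ideal C) = (i \in C).
Proof.
rewrite mono_idealX; apply/meetsP/idP => [[j jC]|iC].
  by rewrite mnm1E; case: eqP => [->|].
by exists i; rewrite // mnm1E eqxx.
Qed.

Lemma var_ideal_strict C C' :
  C \proper C' -> strict_subideal (var_ideal C) (var_ideal C').
Proof.
move=> /properP[/subsetP sub [i iC' iC]]; split.
  move=> f /mono_idealP h; apply/mono_idealP => m /h /meetsP[j jC mj].
  by apply/meetsP; exists j; rewrite ?sub.
by move=> /(_ 'X_i); rewrite !var_idealX (negPf iC) iC' => /(_ isT).
Qed.

End VariableIdeals.

(** * Chains of prime ideals and heights *)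

Section PrimeChains.
Variable R : comNzRingType.
Implicit Types (P Q : {pred R}) (u v : R).

Lemma prime_idealD P u v : prime_ideal P -> u \in P -> v \in P -> u + v \in P.
Proof. by move=> [[_ _ h] _] uP vP; rewrite -[u]mul1r h. Qed.

Lemma prime_idealM P u v : prime_ideal P -> v \in P -> u * v \in P.
Proof. by move=> [[P0 _ h] _] vP; rewrite -[_ * _]addr0 h. Qed.

Lemma prime_idealN P u : prime_ideal P -> u \in P -> - u \in P.
Proof. by move=> hP uP; rewrite -mulN1r prime_idealM. Qed.

Lemma prime_ideal_sum P (I : Type) (r : seq I) (p : pred I) (F : I -> R) :
  prime_ideal P -> (forall i, p i -> F i \in P) -> \sum_(i <- r | p i) F i \in P.
Proof.
move=> hP h; apply: (big_ind (fun f => f \in P)) => //.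
  by case: hP => [[]].
by move=> u v; apply: prime_idealD.
Qed.

Lemma prime_idealMn P u v : prime_ideal P -> u * v \in P -> u \notin P -> v \in P.
Proof. by move=> [_ h] /h /orP[->|]. Qed.

Lemma prime_ideal_prod P (I : Type) (r : seq I) (p : pred I) (F : I -> R) :
  prime_ideal P -> (forall i, p i -> F i \notin P) ->
  \prod_(i <- r | p i) F i \notin P.
Proof.
move=> hP h; apply: (big_ind (fun f => f \notin P)) => //.
  by case: hP => [[]].
by move=> u v uP vP; apply: contra vP => /(prime_idealMn hP); apply.
Qed.

Lemma prime_idealX P u k : prime_ideal P -> u \notin P -> u ^+ k \notin P.
Proof.
move=> hP uP; elim: k => [|k IHk]; first by case: hP => [[]].
by rewrite exprS; apply: contra IHk => /(prime_idealMn hP); apply.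
Qed.

(* At each step only the terms with the least exponent of [f i] survive, since
   [f i] is cancelled modulo [c i] and vanishes modulo [c i.+1]. *)
Lemma prime_chain_relation (k : nat) (c : nat -> {pred R}) (f : nat -> R)
    (T : finType) (a : T -> nat -> nat) (v : T -> R) (A0 : {set T}) :
  (forall i, (i <= k)%N -> prime_ideal (c i)) ->
  (forall i, (i < k)%N -> {subset c i <= c i.+1}) ->
  (forall i, (i < k)%N -> f i \in c i.+1 /\ f i \notin c i) ->
  (forall t t', (forall j, (j < k)%N -> a t j = a t' j) -> t = t') ->
  A0 != set0 -> (forall t, t \in A0 -> v t \notin c k) ->
  \sum_(t in A0) v t * \prod_(0 <= j < k) f j ^+ a t j \notin c 0.
Proof.
move=> cprime csub cf ainj A0n vn; apply/negP => rel0.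
(* After [i] rounds the surviving terms agree in their first [i] exponents, and the relation,
   stripped of those factors, holds modulo [c i]. *)
have step i : (i <= k)%N -> exists A : {set T}, [/\ A \subset A0, A != set0,
    {in A &, forall t t', forall j, (j < i)%N -> a t j = a t' j}
  & \sum_(t in A) v t * \prod_(i <= j < k) f j ^+ a t j \in c i].
  elim: i => [|i IHi] ltik; first by exists A0; split.
  have [A [AA0 /set0Pn[t0' t0'A] Aeq rel]] := IHi (ltnW ltik).
  have [fi fni] := cf i ltik.
  have [t0] := @arg_minnP _ t0' (mem A) (fun t => a t i) t0'A.
  rewrite -[mem A t0]/(t0 \in A) => t0A t0min.
  exists [set t in A | a t i == a t0 i]; split.
  - by apply: subset_trans AA0; apply/subsetP => t; rewrite inE => /andP[].
  - by apply/set0Pn; exists t0; rewrite inE eqxx andbT.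
  - move=> t t'; rewrite !inE => /andP[tA /eqP ti] /andP[t'A /eqP t'i] j.
    rewrite ltnS leq_eqVlt => /orP[/eqP->|]; first by rewrite ti t'i.
    exact: Aeq.
  pose g t := v t * \prod_(i.+1 <= j < k) f j ^+ a t j.
  have inner : \sum_(t in A) f i ^+ (a t i - a t0 i) * g t \in c i.
    have cpi := cprime i (ltnW ltik).
    apply: (@prime_idealMn _ (f i ^+ a t0 i)) => //; last exact: prime_idealX.
    rewrite big_distrr /=; suff <- : \sum_(t in A) v t * \prod_(i <= j < k) f j ^+ a t j
      = \sum_(t in A) f i ^+ a t0 i * (f i ^+ (a t i - a t0 i) * g t) by [].
    apply: eq_bigr => t tA; rewrite mulrA -exprD subnKC; last exact: (t0min t tA).
    by rewrite big_ltn // /g !mulrA [v t * _]mulrC.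
  have /csub := inner; move=> /(_ ltik).
  rewrite (bigID (fun t => a t i == a t0 i)) /= => sumin.
  have cp := cprime _ ltik.
  have high : \sum_(t in A | a t i != a t0 i)
      f i ^+ (a t i - a t0 i) * g t \in c i.+1.
    apply: prime_ideal_sum => // t /andP[tA neq].
    have lt0 : (0 < a t i - a t0 i)%N.
      by rewrite subn_gt0 ltn_neqAle eq_sym neq; apply: (t0min t tA).
    by rewrite -(prednK lt0) exprSr -mulrA prime_idealM // mulrC prime_idealM.
  have := prime_idealD cp sumin (prime_idealN cp high); rewrite addrK.
  suff -> : \sum_(t in A | a t i == a t0 i) f i ^+ (a t i - a t0 i) * g t
    = \sum_(t in [set t in A | a t i == a t0 i]) g t by [].
  apply: eq_big => t; first by rewrite inE.
  by move=> /andP[_ /eqP->]; rewrite subnn mul1r.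
(* After [k] rounds a single term is left, and the relation says that [v t] lies in [c k]. *)
have [A [AA0 /set0Pn[t tA] Aeq]] := step k (leqnn k).
have -> : A = [set t].
  apply/eqP; rewrite eqEsubset sub1set tA andbT; apply/subsetP => t' t'A.
  by rewrite inE; apply/eqP; apply: ainj => j; apply: Aeq.
by rewrite big_set1 big_geq // mulr1; apply/negP/vn/(subsetP AA0).
Qed.

Lemma prime_chain_rcons c h P Q :
  prime_chain c h P -> strict_subideal P Q -> prime_ideal Q ->
  exists c', prime_chain c' h.+1 Q.
Proof.
move=> [cprime cstrict cP] [PQ QP] hQ.
exists (fun i => if (i <= h)%N then c i else Q); split=> [i _|i|f].
- by case: ifP => // /cprime.
- rewrite ltnS; case: ltngtP => [lti|//|->] _; first exact: cstrict.
  split=> [f|sub]; first by rewrite cP => /PQ.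
  by apply: QP => f /sub; rewrite cP.
- by rewrite /= ltnn.
Qed.

Lemma has_height_uniq P h k : has_height P h -> has_height P k -> h = k.
Proof.
move=> [[c hc] hmax] [[d hd] kmax]; apply/eqP; rewrite eqn_leq.
by rewrite (kmax c) // (hmax d).
Qed.

Lemma eq_has_height P Q h : P =i Q -> has_height P h -> has_height Q h.
Proof.
have eq_chain c k P1 P2 : P1 =i P2 -> prime_chain c k P1 -> prime_chain c k P2.
  by move=> eqP [c1 c2 c3]; split=> // f; rewrite c3 eqP.
move=> PQ [[c hc] hmax]; split; first by exists c; apply: eq_chain hc.
by move=> d k hd; apply: (hmax d); apply: eq_chain hd => f; rewrite PQ.
Qed.

End PrimeChains.

(** * Dimension of the polynomial ring and heights of variable ideals *)

Section Dimension.
Variables (K : fieldType) (n : nat).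
Implicit Types (f g : {mpoly K[n]}) (m : 'X_{1..n}) (C : {set 'I_n}).

Definition mdeg_bounded (e : nat) f := forall m, m \in msupp f -> (mdeg m <= e)%N.

Lemma mdeg_boundedM e1 e2 f g :
  mdeg_bounded e1 f -> mdeg_bounded e2 g -> mdeg_bounded (e1 + e2) (f * g).
Proof.
move=> hf hg m /msuppM_le /allpairsP[[m1 m2] /= [m1f m2g ->]].
by rewrite mdegD leq_add ?hf ?hg.
Qed.

Lemma mdeg_bounded1 : mdeg_bounded 0 1.
Proof. by move=> m; rewrite msupp1 inE => /eqP->; rewrite mdeg0. Qed.

Lemma mdeg_boundedX e f k : mdeg_bounded e f -> mdeg_bounded (k * e) (f ^+ k).
Proof.
move=> hf; elim: k => [|k IHk]; first by rewrite mul0n expr0; apply: mdeg_bounded1.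
by rewrite exprS mulSn; apply: mdeg_boundedM.
Qed.

Lemma mdeg_boundedW e1 e2 f : (e1 <= e2)%N -> mdeg_bounded e1 f -> mdeg_bounded e2 f.
Proof. by move=> le h m /h /leq_trans; apply. Qed.

(* The [d ^ k] products of powers with exponents below [d] lie in a space of
   dimension [O(d ^ n)]. *)
Lemma algebraic_dependence (k : nat) (f : nat -> {mpoly K[n]}) :
  (n < k)%N ->
  exists d (v : {ffun 'I_k -> 'I_d} -> K),
    (exists t, v t != 0) /\
    \sum_t v t *: \prod_(j < k) f j ^+ t j = 0.
Proof.
move=> ltnk; pose e := (\max_(j < k) msize (f j))%N.
(* The products have degree below [B], and [B <= d * (k * e).+1]. Since [d] exceeds
   [(k * e).+1 ^ n], this gives [B ^ n < d ^ n.+1 <= d ^ k]: more products than available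
   monomials. *)
pose d := ((k * e).+1 ^ n).+1; pose B := (k * (d * e)).+1.
pose T := {ffun 'I_k -> 'I_d}; pose S := {ffun 'I_n -> 'I_B}.
have fdeg (j : 'I_k) : mdeg_bounded e (f j).
  move=> m /msize_mdeg_lt /ltnW /leq_trans; apply.
  exact: (leq_bigmax (F := fun j : 'I_k => msize (f j))).
pose F (t : T) := \prod_(j < k) f j ^+ t j.
have Fdeg t : mdeg_bounded (k * (d * e)) (F t).
  have -> : (k * (d * e) = \sum_(j < k) d * e)%N by rewrite sum_nat_const card_ord.
  apply: (big_ind2 (fun (e : nat) g => mdeg_bounded e g)).
  - exact: mdeg_bounded1.
  - by move=> e1 g1 e2 g2; apply: mdeg_boundedM.
  - move=> j _; apply: (mdeg_boundedW _ (mdeg_boundedX (fdeg j))).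
    by rewrite leq_mul2r ltnW ?orbT.
pose mon (s : S) : 'X_{1..n} := [multinom (s i : nat) | i < n].
pose M : 'M[K]_(#|T|, #|S|) := \matrix_(i, j) (F (enum_val i))@_(mon (enum_val j)).
have cardlt : (#|S| < #|T|)%N.
  rewrite !card_ffun !card_ord.
  have leB : (B <= d * (k * e).+1)%N by rewrite /B mulnS mulnCA -addn1 addnC leq_add2r.
  apply: (@leq_ltn_trans ((d * (k * e).+1) ^ n)).
    by have [n0|n0] := posnP n; [rewrite n0 | rewrite leq_exp2r].
  rewrite expnMn; apply: (@leq_trans (d ^ n * d)).
    by rewrite ltn_pmul2l ?expn_gt0.
  by rewrite -expnSr leq_pexp2l.
have kerN0 : kermx M != 0.
  by rewrite -mxrank_eq0 mxrank_ker subn_eq0 -ltnNge (leq_ltn_trans (rank_leq_col M)).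
pose w := nz_row (kermx M).
have wM : w *m M = 0 by apply/sub_kermxP; apply: nz_row_sub.
exists d, (fun t => w ord0 (enum_rank t)); split.
  have : w != 0 by rewrite nz_row_eq0.
  case/rV0Pn => j wj; exists (enum_val j); rewrite enum_valK //.
apply/mpolyP => m; rewrite mcoeff0 raddf_sum /=.
have [ltm|lem] := ltnP (mdeg m) B; last first.
  apply: big1 => t _; rewrite mcoeffZ memN_msupp_eq0 ?mulr0 //.
  by apply/negP => /Fdeg; rewrite leqNgt lem.
have ltmi i : (m i < B)%N.
  by apply: leq_ltn_trans ltm; rewrite mdegE (bigD1 i) //= leq_addr.
pose s : S := [ffun i => Ordinal (ltmi i)].
have -> : m = mon s by apply/mnmP => i; rewrite mnmE ffunE.
have /matrixP/(_ ord0 (enum_rank s)) := wM; rewrite !mxE => wMs; rewrite -[RHS]wMs.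
rewrite [LHS](reindex_onto enum_val enum_rank) /=; last by move=> t _; rewrite enum_rankK.
apply: eq_big => [i|i _]; first by rewrite enum_valK eqxx.
by rewrite mcoeffZ mxE enum_rankK enum_valK.
Qed.

(** Pick [f i] in [c i.+1] but not in [c i]. If [k > n], these are algebraically dependent over [K],
    against [prime_chain_relation]: nonzero constants are units and lie outside [c k]. *)
Lemma prime_chain_leq (c : nat -> {pred {mpoly K[n]}}) k P :
  prime_chain c k P -> (k <= n)%N.
Proof.
move=> [cprime cstrict _]; rewrite leqNgt; apply/negP => ltnk.
have [|f fP] := @choice _ _ (fun i (g : {mpoly K[n]}) =>
    (i < k)%N -> g \in c i.+1 /\ g \notin c i).
  move=> i.
  have [ltik|_] := ltnP i k; last by exists 0.
  have [_ nsub] := cstrict i ltik.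
  apply: contrapT => h; apply: nsub => g gi; apply/negPn/negP => gni.
  by apply: h; exists g.
have [d [v [[t0 vt0] rel]]] := algebraic_dependence f ltnk.
pose a (t : {ffun 'I_k -> 'I_d}) (j : nat) : nat :=
  if insub j is Some i then t i else 0%N.
have aE t (i : 'I_k) : a t i = t i by rewrite /a valK.
suff: \sum_(t in [set t | v t != 0]) (v t)%:MP * \prod_(0 <= j < k) f j ^+ a t j
    \notin c 0%N.
  have -> : \sum_(t in [set t | v t != 0]) (v t)%:MP * \prod_(0 <= j < k) f j ^+ a t j
     = \sum_t v t *: \prod_(j < k) f j ^+ t j.
    rewrite [RHS](bigID (fun t => v t != 0)) /= [X in _ + X]big1 ?addr0.
      apply: eq_big => [t|t _]; first by rewrite inE.
      rewrite mul_mpolyC big_mkord; congr (_ *: _).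
      by apply: eq_bigr => j _; rewrite aE.
    by move=> t /negPn/eqP->; rewrite scale0r.
  by have [[c0 _ _] _] := cprime 0%N (leq0n k); rewrite rel c0.
apply: prime_chain_relation => //.
- by move=> i /cstrict[].
- move=> t t' h; apply/ffunP => i; apply/val_inj.
  by rewrite /= -!aE h.
- by apply/set0Pn; exists t0; rewrite inE.
- move=> t; rewrite inE => vt; apply/negP => vk.
  have cpk := cprime k (leqnn k).
  have := prime_idealM ((v t)^-1)%:MP cpk vk; rewrite -mpolyCM mulVf //.
  by case: cpk => [[_ /negP]].
Qed.

(** The missing variables are adjoined one at a time. *)
Lemma prime_chain_var_ideal (c : nat -> {pred {mpoly K[n]}}) h C C' :
  C \subset C' -> prime_chain c h (var_ideal C) ->
  exists c', prime_chain c' (h + #|C' :\: C|) (var_ideal (K := K) C').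
Proof.
move=> CC' hc; have [k] := ubnP #|C' :\: C|; elim: k C' CC' => // k IHk C' CC' ltk.
have [CC'0|[x xC']] := set_0Vmem (C' :\: C).
  have -> : C' = C by apply/eqP; rewrite eqEsubset CC' andbT -setD_eq0 CC'0.
  by exists c; rewrite setDv cards0 addn0.
have xD : x \in C' /\ x \notin C by move: xC'; rewrite inE => /andP[].
case: xD => xC'1 xC.
have CC'x : C \subset C' :\ x by rewrite subsetD1 CC' xC.
have cardD : #|C' :\: C| = #|(C' :\ x) :\: C|.+1.
  by rewrite (cardsD1 x) xC' add1n setDDl setUC -setDDl.
have [||c' hc'] := IHk (C' :\ x) => //; first by rewrite cardD in ltk.
have strict := var_ideal_strict K (properD1 xC'1).
by rewrite cardD addnS; apply: prime_chain_rcons hc' strict (var_ideal_prime K C').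
Qed.

(* A chain ending in [var_ideal C] extends to one ending in the ideal of all
   variables, so its length is at most [n - (n - #|C|)]. *)
Lemma var_ideal_height C : has_height (var_ideal (K := K) C) #|C|.
Proof.
split=> [|c k hc].
  have [||c hc] := @prime_chain_var_ideal (fun=> var_ideal set0) 0 set0 C.
  - exact: sub0set.
  - by split=> // i _; apply: var_ideal_prime.
  by exists c; rewrite setD0 add0n in hc.
have [|c' /prime_chain_leq] := @prime_chain_var_ideal c k C setT _ hc.
  exact: subsetT.
by rewrite setTD => lek; rewrite -(leq_add2r #|~: C|) cardsC card_ord.
Qed.

Lemma same_height_var_ideal P Q C C' :
  P =i var_ideal (K := K) C -> Q =i var_ideal C' ->
  same_height P Q <-> #|C| = #|C'|.
Proof.
move=> PC QC'.
have hP : has_height P #|C|.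
  by apply: eq_has_height (var_ideal_height C) => f; rewrite PC.
have hQ : has_height Q #|C'|.
  by apply: eq_has_height (var_ideal_height C') => f; rewrite QC'.
split=> [hPQ|eqC h].
  by apply: has_height_uniq hQ; apply/hPQ.
by split=> [/(has_height_uniq hP)|/(has_height_uniq hQ)] <-; rewrite ?eqC // -eqC.
Qed.

End Dimension.

(** * The part of a polynomial outside a monomial ideal *)

Section RestrictSupport.
Variables (K : fieldType) (n : nat).
Implicit Types (f g : {mpoly K[n]}) (m : 'X_{1..n}).

Definition restrict (p : pred 'X_{1..n}) f := \sum_(m <- msupp f | p m) f@_m *: 'X_[m].

Lemma mcoeff_restrict p f m : (restrict p f)@_m = if p m then f@_m else 0.
Proof.
rewrite raddf_sum /=; case: ifP => pm.
  rewrite [in RHS](mpolyE f) raddf_sum /= [RHS](bigID p) /= [X in _ + X]big1 ?addr0 //.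
  move=> m' pm'; rewrite mcoeffZ mcoeffX; case: eqP pm' => [->|_ _].
    by rewrite pm.
  by rewrite mulr0.
apply: big1 => m' pm'; rewrite mcoeffZ mcoeffX; case: eqP pm' => [->|_ _].
  by rewrite pm.
by rewrite mulr0.
Qed.

Lemma mono_ideal_restrict (U : pred 'X_{1..n}) f :
  f - restrict (predC U) f \in mono_ideal U.
Proof.
apply/mono_idealP => m; rewrite mcoeffB mcoeff_restrict /=.
by case: (U m); rewrite //= subrr eqxx.
Qed.

(* The monomials of [g] do not change membership in [U], so [g] kills the part
   of [f] outside [U]. *)
Lemma mono_ideal_regular (U : pred 'X_{1..n}) f g :
  upward_closed U ->
  (forall m m', m \in msupp g -> U (m + m')%MM -> U m') ->
  g != 0 -> g * f \in mono_ideal U -> f \in mono_ideal U.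
Proof.
move=> upU gU g0 gf; set f1 := restrict (predC U) f.
have f1U : f - f1 \in mono_ideal U by apply: mono_ideal_restrict.
have gf1 : g * f1 \in mono_ideal U.
  rewrite -[f1](subKr f) mulrBr -mulNr; apply: mono_idealD => //.
  by rewrite mulNr -mulrN mono_idealM // -scaleN1r mono_idealZ.
suff f10 : f1 = 0 by rewrite f10 subr0 in f1U.
apply/eqP; have : g * f1 == 0.
  apply/eqP/mpolyP => m; rewrite mcoeff0; apply/eqP/negPn/negP => gf1m.
  have Um := mono_idealP _ _ gf1 m gf1m.
  move: gf1m; rewrite -mcoeff_msupp => /msuppM_le /allpairsP[[m1 m2] /= [m1g m2f mE]].
  move: m2f; rewrite mcoeff_msupp mcoeff_restrict /=; case: ifP; rewrite ?eqxx //.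
  by move=> /negP[]; apply: gU m1g _; rewrite -mE.
by rewrite mulf_eq0 (negPf g0).
Qed.

Lemma var_ideal_subset (C : {set 'I_n}) (Q : {pred {mpoly K[n]}}) :
  prime_ideal Q -> (forall i, i \in C -> 'X_i \in Q) ->
  {subset var_ideal (K := K) C <= Q}.
Proof.
move=> hQ XQ f /mono_idealP fC; rewrite (mpolyE f) big_seq.
apply: prime_ideal_sum => // m; rewrite mcoeff_msupp => /fC /meetsP[i iC mi].
have le1m : (U_(i) <= m)%MM by rewrite lep1mP -lt0n.
rewrite -[in X in X \in _](submK le1m).
by rewrite mpolyXD scalerAl prime_idealM ?XQ.
Qed.

End RestrictSupport.

(** * The edge ideal, its monomials and its strong covers *)

Section EdgeIdeal.
Variables (K : fieldType) (n : nat) (D : wograph n).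
Implicit Types (x y z a b : 'I_n) (M : {set 'I_n}) (P : {set {set 'I_n}}).
Implicit Types (m : 'X_{1..n}).

Lemma arc_irr x : arc D x x = false.
Proof. by apply/negP => xx; have := arc_asym xx; rewrite xx. Qed.

Lemma edgesE x y : ([set x; y] \in edges D) = arc D x y || arc D y x.
Proof.
apply/imsetP/orP => [[[a b]]|[xy|yx]]; last 2 first.
- by exists (x, y); rewrite ?inE.
- by exists (y, x); rewrite ?inE //= setUC.
rewrite inE /= => ab eqs.
have : x \in [set a; b] by rewrite -eqs set21.
have : y \in [set a; b] by rewrite -eqs set22.
have : a \in [set x; y] by rewrite eqs set21.
have : b \in [set x; y] by rewrite eqs set22.
rewrite !inE => bxy axy /orP[]/eqP yE /orP[]/eqP xE; subst x y.
- by rewrite orbb in bxy; rewrite (eqP bxy) arc_irr in ab.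
- by right.
- by left.
- by rewrite orbb in axy; rewrite (eqP axy) arc_irr in ab.
Qed.

Lemma adjE x y : adj D x y = arc D x y || arc D y x.
Proof. exact: edgesE. Qed.

Lemma adj_sym : ssrbool.symmetric (adj D).
Proof. by move=> x y; rewrite !adjE orbC. Qed.

Lemma adj_irr : irreflexive (adj D).
Proof. by move=> x; rewrite adjE arc_irr. Qed.

Lemma in_nbhdE x y : (y \in nbhd D x) = adj D x y.
Proof. by rewrite !inE adjE. Qed.

Definition edge_mono m :=
  [exists e : 'I_n * 'I_n,
    [&& arc D e.1 e.2, (0 < m e.1)%N & (weight D e.2 <= m e.2)%N]].

Lemma edge_monoP m :
  reflect (exists x y, [/\ arc D x y, (0 < m x)%N & (weight D y <= m y)%N])
          (edge_mono m).
Proof.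
apply: (iffP existsP) => [[[x y] /and3P[]]|[x [y [xy mx my]]]].
  by exists x, y.
by exists (x, y); apply/and3P.
Qed.

Lemma edge_idealE : edge_ideal D K =i mono_ideal edge_mono.
Proof.
rewrite /edge_ideal.
have -> : (fun e : 'I_n * 'I_n => 'X_(e.1) * 'X_(e.2) ^+ weight D e.2 : {mpoly K[n]})
    = (fun e => 'X_[U_(e.1) + U_(e.2) *+ weight D e.2]).
  by apply: funext => e; rewrite mpolyXD mpolyXn.
move=> f; rewrite ideal_gen_monomials; apply: eq_mono_ideal => m.
apply: eq_existsb => -[x y] /=; rewrite inE /=.
have [xy /=|//] := boolP (arc D x y).
have neq : x != y by apply/eqP => eqxy; rewrite eqxy arc_irr in xy.
apply/mnm_lepP/andP => [h|[mx my] i].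
  have := h x; have := h y; rewrite !mnmDE !mulmnE !mnm1E !eqxx.
  by rewrite (negPf neq) eq_sym (negPf neq) mul0n mul1n add0n addn0.
rewrite mnmDE mulmnE !mnm1E; case: (eqVneq x i) => [<-|_].
  by rewrite eq_sym (negPf neq) mul0n addn0.
by case: (eqVneq y i) => [<-|_]; rewrite ?mul1n ?mul0n.
Qed.

Definition out_meets M x := [exists z in M, arc D x z].

Lemma out_meetsP M x : reflect (exists2 z, z \in M & arc D x z) (out_meets M x).
Proof. exact: exists_inP. Qed.

(* The complement of [M] is a strong vertex cover: the second alternative is
   the condition on its vertices all of whose neighbours are in the cover. *)
Lemma strong_cover_associated M :
  independent (adj D) M ->
  (forall x, x \notin M -> (exists2 y, y \in M & adj D x y) \/
     exists y, [/\ arc D y x, y \notin M, ~~ out_meets M y & (1 < weight D y)%N]) ->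
  associated_prime (edge_ideal D K) (var_ideal (K := K) (~: M)).
Proof.
move=> /independentP iM dom; split; first exact: var_ideal_prime.
(* This monomial lies just outside [I(D)]. A further variable [x] outside [M] either becomes the
   tail of an arc into [M], whose head has full weight, or reaches its own weight as head of an arc
   from a vertex with positive exponent. *)
pose e x := if x \in M then weight D x
            else if out_meets M x then 0%N else (weight D x).-1.
exists 'X_[[multinom e x | x < n]] => f.
rewrite edge_idealE mono_idealMX; apply: eq_mono_ideal => m.
apply/meetsP/edge_monoP => [[x]|[x [y []]]].
  rewrite inE => xM mx; have [/out_meetsP[y yM xy]|noout] := boolP (out_meets M x).
    exists x, y; rewrite !mnmDE !mnmE /e yM leq_addr; split=> //.
    by rewrite addn_gt0 mx orbT.
  have ex : (weight D x <= e x + m x)%N.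
    rewrite /e (negPf xM) (negPf noout) -{1}(prednK (weight_gt0 D x)) -addn1.
    by rewrite leq_add2l.
  case: (dom x xM) => [[y yM]|[y [yx yM nouty wy]]].
    rewrite adjE => /orP[xy|yx].
      by case/negP: noout; apply/out_meetsP; exists y.
    exists y, x; rewrite !mnmDE !mnmE; split=> //.
    by rewrite /e yM ltn_addr ?weight_gt0.
  exists y, x; rewrite !mnmDE !mnmE; split=> //.
  by rewrite {1}/e (negPf yM) (negPf nouty) ltn_addr // -ltnS prednK ?weight_gt0.
rewrite !mnmDE !mnmE => xy ex ey.
(* If the head is in [M], the tail has exponent 0 in [e]; if not, the head is below its weight in
   [e]. Either way [m] must contribute a variable outside [M]. *)
have [yM|yM] := boolP (y \in M).
  have xM : x \notin M.
    by apply/negP => xM; have := iM x y xM yM; rewrite adjE xy.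
  exists x; first by rewrite inE.
  have xo : out_meets M x by apply/out_meetsP; exists y.
  by move: ex; rewrite /e (negPf xM) xo.
exists y; first by rewrite inE.
move: ey; rewrite /e (negPf yM); case: (posnP (m y)) => // ->; rewrite addn0.
case: ifP => _; have := weight_gt0 D y; first by case: (weight D y).
by case: (weight D y) => //= k _; rewrite ltnn.
Qed.

Lemma maximal_independent_associated M :
  maximal_independent (adj D) setT M ->
  associated_prime (edge_ideal D K) (var_ideal (K := K) (~: M)).
Proof.
move=> /(maximal_independentP adj_sym)[_ iM Mmax].
apply: strong_cover_associated => // x xM; left.
by apply: Mmax => //; rewrite adj_irr.
Qed.

(** * Associated primes in the presence of a matching satisfying (1) and (2) *)

Section Matching.
Variable P : {set {set 'I_n}}.
Hypothesis P_perfect : perfect_matching D P.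
Hypothesis P_prop : property_P D P.

Lemma matching_block (B : {set 'I_n}) :
  B \in P -> exists x y, B = [set x; y] /\ adj D x y.
Proof.
case: P_perfect => /subsetP PE _ _ /PE/imsetP[[x y] /=]; rewrite inE /= => xy ->.
by exists x, y; rewrite adjE xy.
Qed.

Lemma matching_partner x : exists y, [set x; y] \in P.
Proof.
case: P_perfect => _ _ cov.
have : x \in cover P by rewrite cov inE.
case/bigcupP => B BP; have [y [z [BE _]]] := matching_block BP.
rewrite BE in BP *; rewrite !inE => /orP[]/eqP->; first by exists z.
by exists y; rewrite setUC.
Qed.

Lemma card_matching M : #|M| = (\sum_(B in P) #|M :&: B|)%N.
Proof.
case: P_perfect => _ triv cov.
transitivity (\sum_(x in cover P) (x \in M))%N.
  by rewrite cov -sum1_card big_mkcond; apply: eq_bigl => x; rewrite inE.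
rewrite (big_trivIset _ triv); apply: eq_bigr => B _.
rewrite -sum1_card [RHS](eq_bigl (fun x => (x \in B) && (x \in M))) => [|x].
  by rewrite [RHS]big_mkcondr.
by rewrite inE andbC.
Qed.

Lemma independent_block M (B : {set 'I_n}) :
  independent (adj D) M -> B \in P -> (#|M :&: B| <= 1)%N.
Proof.
move=> /independentP iM /matching_block[x [y [-> xy]]].
have [xM|xM] := boolP (x \in M).
  have yM : y \notin M by apply/negP => yM; have := iM x y xM yM; rewrite xy.
  rewrite -(cards1 x); apply/subset_leq_card/subsetP => z; rewrite !inE.
  by case/andP => zM /orP[//|/eqP zy]; rewrite zy (negPf yM) in zM.
rewrite -(cards1 y); apply/subset_leq_card/subsetP => z; rewrite !inE.
by case/andP => zM /orP[/eqP zx|//]; rewrite zx (negPf xM) in zM.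
Qed.

(** If both ends were missing, each would have a neighbour in [M], and (P) would make these
    neighbours adjacent. *)
Lemma maximal_meets_block M b b' :
  maximal_independent (adj D) setT M -> [set b; b'] \in P ->
  (b \in M) || (b' \in M).
Proof.
move=> /(maximal_independentP adj_sym)[_ /independentP iM Mmax] bP.
apply/negPn/negP; rewrite negb_or => /andP[bM b'M].
have [||a aM ba] := Mmax b _ bM; rewrite ?adj_irr ?inE //.
have [||a' a'M ba'] := Mmax b' _ b'M; rewrite ?adj_irr ?inE //.
have /negP := iM a a' aM a'M; apply; apply: (P_prop _ _ bP).
  by rewrite edgesE -adjE adj_sym.
by rewrite edgesE -adjE adj_sym.
Qed.

Lemma card_maximal_independent M :
  maximal_independent (adj D) setT M -> #|M| = #|P|.
Proof.
move=> Mmax; have [_ iM _] := maximal_independentP adj_sym _ _ Mmax.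
rewrite card_matching -sum1_card; apply: eq_bigr => B BP.
apply/eqP; rewrite eqn_leq independent_block //= card_gt0.
have [x [y [BE _]]] := matching_block BP; rewrite BE in BP *.
by apply/set0Pn; have /orP[h|h] := maximal_meets_block Mmax BP;
  [exists x | exists y]; rewrite !inE h eqxx ?orbT.
Qed.

Lemma card_independent_missing M b b' :
  independent (adj D) M -> [set b; b'] \in P -> b \notin M -> b' \notin M ->
  (#|M| < #|P|)%N.
Proof.
move=> iM bP bM b'M; rewrite card_matching -sum1_card.
rewrite (bigD1 _ bP) [X in (_ < X)%N](bigD1 _ bP) /=.
have -> : M :&: [set b; b'] = set0.
  apply/setP => z; rewrite !inE; apply/negP => /andP[zM /orP[]/eqP zE].
    by rewrite -zE zM in bM.
  by rewrite -zE zM in b'M.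
rewrite cards0 add0n add1n ltnS; apply: leq_sum => B /andP[BP _].
exact: independent_block.
Qed.

Hypothesis P_weight : forall a b b' : 'I_n,
  (1 < weight D a)%N -> b' \in out_nbhd D a -> [set b; b'] \in P ->
  nbhd D b \subset out_nbhd D a.

(** Exponents of the irreducible ideal generated by the vertices outside [M] with an arc into [M]
    and by the powers [x ^ w(x)] of the other vertices outside [M]. *)
Definition component_mono M m :=
  [exists x, (x \notin M) &&
    if out_meets M x then (0 < m x)%N else (weight D x <= m x)%N].

Lemma component_monoP M m :
  reflect (exists2 x, x \notin M &
             if out_meets M x then (0 < m x)%N else (weight D x <= m x)%N)
          (component_mono M m).
Proof. exact: exists_inP. Qed.

Lemma component_mono_up M : upward_closed (component_mono M).
Proof.
move=> m m' /component_monoP[x xM h]; apply/component_monoP; exists x => //.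
by rewrite mnmDE; case: ifP h => _ h; apply: leq_trans h (leq_addr _ _).
Qed.

Lemma edge_mono_component M m :
  independent (adj D) M -> edge_mono m -> component_mono M m.
Proof.
move=> /independentP iM /edge_monoP[x [y [xy mx my]]]; apply/component_monoP.
have [yM|yM] := boolP (y \in M).
  have xM : x \notin M.
    by apply/negP => xM; have := iM x y xM yM; rewrite adjE xy.
  by exists x => //; case: ifPn => // /negP[]; apply/out_meetsP; exists y.
by exists y => //; case: ifP => // _; apply: leq_trans (weight_gt0 D y) my.
Qed.

(* A maximal independent set containing the vertices [x] with [m x >= w x] and,
   for every other [a] with [m a > 0], the partners of the out-neighbours of
   [a] (so that it avoids [N+(a)]). *)
Lemma component_mono_edge m :
  ~~ edge_mono m ->
  exists2 M, maximal_independent (adj D) setT M & ~~ component_mono M m.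
Proof.
move=> /edge_monoP nm.
pose full := [set x | weight D x <= m x]%N.
pose partial := [set x | 0 < m x < weight D x]%N.
pose T := [set b | [exists a in partial, exists b', arc D a b' && ([set b; b'] \in P)]].
have fullpos x : x \in full -> (0 < m x)%N.
  by rewrite inE; apply: leq_trans (weight_gt0 D x).
have TP b : b \in T -> exists a, [/\ (0 < m a)%N, {subset nbhd D b <= out_nbhd D a}
    & exists2 b', arc D a b' & [set b; b'] \in P].
  rewrite inE => /exists_inP[a]; rewrite inE => /andP[ma wa].
  move=> /existsP[b' /andP[ab' bb']]; exists a; split=> //; last by exists b'.
  by apply/subsetP; apply: P_weight bb'; rewrite ?inE // (leq_ltn_trans ma).
(* For an edge between [b] and [c] in [T], with witnesses [a] and [a2], the inclusions from (2)
   yield arcs from [a] to [c] and from [a2] to [b]. Applied again, they yield arcs between [a] and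
   [a2] in both directions. *)
have iT : independent (adj D) T.
  apply/independentP => b c /TP[a [_ sub [b' ab' bb']]] /TP[a2 [_ sub2 [c' a2c' cc']]].
  apply/negP => bc.
  have ac : arc D a c by have := sub c; rewrite in_nbhdE inE; apply.
  have a2b : arc D a2 b by have := sub2 b; rewrite in_nbhdE adj_sym inE; apply.
  have a2a : arc D a2 a.
    by have := sub2 a; rewrite in_nbhdE adjE ac orbT inE; apply.
  have aa2 : arc D a a2.
    by have := sub a2; rewrite in_nbhdE adjE a2b orbT inE; apply.
  by have := arc_asym aa2; rewrite a2a.
have ifull : independent (adj D) full.
  apply/independentP => x y xf yf; rewrite adjE; apply/negP => /orP[xy|yx]; apply: nm.
    by exists x, y; split; rewrite ?fullpos //; move: yf; rewrite inE.
  by exists y, x; split; rewrite ?fullpos //; move: xf; rewrite inE.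
have [||M Mmax subM] := @maximal_independent_exists _ (adj D) setT (full :|: T).
- exact: subsetT.
- apply: (independentU adj_sym) => // x b xf /TP[a [ma sub _]]; rewrite adj_sym.
  apply/negP => bx; apply: nm; exists a, x; split=> //.
    by have := sub x; rewrite in_nbhdE bx inE; apply.
  by move: xf; rewrite inE.
exists M => //.
have [_ iM _] := maximal_independentP adj_sym _ _ Mmax.
have fullM x : x \in full -> x \in M.
  by move=> xf; apply: (subsetP subM); rewrite inE xf.
apply/negP => /component_monoP[x xM].
have xfull : (m x < weight D x)%N.
  by rewrite ltnNge; apply: contra xM => ?; apply: fullM; rewrite inE.
(* If also [m x > 0], then [x] is in [partial], so the partner of [b'] is in [T] and [M] contains a
   whole matching edge. *)
case: ifP => [/out_meetsP[b' b'M xb']|_]; last by rewrite leqNgt xfull.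
move=> mx; have [b bb'] := matching_partner b'; rewrite setUC in bb'.
have bM : b \in M.
  apply: (subsetP subM); rewrite in_setU; apply/orP; right; rewrite inE.
  apply/exists_inP; exists x; first by rewrite inE mx.
  by apply/existsP; exists b'; rewrite xb'.
have /negP := independentP _ _ iM b b' bM b'M; apply.
by case: P_perfect => /subsetP PE _ _; apply: PE.
Qed.

(** Primality of [Q = (I(D) : f)] makes it equal to [(I_ M : f)] for a single component; modulo
    [I_ M] the variables outside [M] are nilpotent and nonzero polynomials in the others are
    regular. *)
Lemma associated_edge_ideal Q :
  associated_prime (edge_ideal D K) Q ->
  exists2 M, maximal_independent (adj D) setT M & Q =i var_ideal (K := K) (~: M).
Proof.
move=> [hQ [f Qf]].
pose I_ M := mono_ideal (K := K) (component_mono M).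
have QI M g : maximal_independent (adj D) setT M -> g \in Q -> g * f \in I_ M.
  move=> /(maximal_independentP adj_sym)[_ iM _].
  rewrite Qf edge_idealE => /mono_idealP gf; apply/mono_idealP => m /gf h.
  exact: edge_mono_component iM h.
have [M Mmax MQ] : exists2 M, maximal_independent (adj D) setT M &
    forall g, g * f \in I_ M -> g \in Q.
  apply: contrapT => noM.
  have [|g gP] := @choice _ _ (fun M g => maximal_independent (adj D) setT M ->
      g * f \in I_ M /\ g \notin Q).
    move=> M; have [Mmax|//] := boolP (maximal_independent (adj D) setT M); last by exists 0.
    apply: contrapT => h; apply: noM; exists M => // g gf; apply/negPn/negP => gQ.
    by apply: h; exists g.
  (* The product sends [f] into every component, hence into their intersection [I(D)], so it would
     have to lie in [Q]. *)
  have : \prod_(M | maximal_independent (adj D) setT M) g M \notin Q.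
    by apply: prime_ideal_prod => // M /gP[].
  rewrite Qf edge_idealE => /negP; apply; apply/mono_idealP => m hm.
  apply: contraT => nm; have [M Mmax nc] := component_mono_edge nm.
  case/negP: nc.
  move: m hm {nm}; apply/mono_idealP; rewrite (bigD1 M) //= mulrAC mulrC.
  apply: mono_idealM; first exact: component_mono_up.
  by have [] := gP M Mmax.
have [_ iM _] := maximal_independentP adj_sym _ _ Mmax.
have upM := @component_mono_up M.
have sub : {subset var_ideal (K := K) (~: M) <= Q}.
  apply: var_ideal_subset => // i; rewrite inE => iM'.
  apply/negPn/negP => /(prime_idealX (weight D i) hQ) /negP; apply.
  apply: MQ; rewrite mulrC mono_idealM // mpolyXn mono_idealX.
  apply/component_monoP; exists i => //; rewrite mulmnE mnm1E eqxx mul1n leqnn.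
  by rewrite weight_gt0 if_same.
have fI : f \notin I_ M.
  have [[_ Q1 _] _] := hQ; apply: contra Q1 => fI; apply: MQ; by rewrite mul1r.
exists M => // g; apply/idP/idP; last exact: sub.
(* The polynomial [kill (~: M) g] is in [Q] and involves only variables of [M]; if nonzero, it is
   regular modulo [I_ M] and forces [f] into [I_ M]. *)
move=> gQ; rewrite var_idealE; apply/negPn/negP => k0; case/negP: fI.
apply: (mono_ideal_regular upM _ k0).
  move=> m m'; rewrite mcoeff_msupp mcoeff_kill; case: ifPn => [|nm _]; rewrite ?eqxx //.
  move=> /component_monoP[x xM hx]; apply/component_monoP; exists x => //.
  have mx0 : m x = 0%N.
    by apply/eqP; rewrite -leqn0 leqNgt; apply: contra nm => ?; apply/meetsP;
      exists x; rewrite ?inE.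
  by move: hx; rewrite mnmDE mx0.
apply: QI => //; rewrite -[kill _ g](subKr g); apply: prime_idealD => //.
by apply: prime_idealN => //; apply/sub/kill_sub.
Qed.

Lemma matching_unmixed : unmixed (edge_ideal D K).
Proof.
move=> Q1 Q2 /associated_edge_ideal[M1 max1 Q1E] /associated_edge_ideal[M2 max2 Q2E].
apply/(same_height_var_ideal Q1E Q2E)/eqP.
by rewrite -(eqn_add2l #|M1|) cardsC (card_maximal_independent max1)
  -(card_maximal_independent max2) cardsC.
Qed.

End Matching.

End EdgeIdeal.

(** * Conditions (1) and (2) from unmixedness *)

Section Unmixed.
Variables (K : fieldType) (n : nat) (D : wograph n).
Hypothesis D_unmixed : unmixed (edge_ideal D K).
Implicit Types (x y a b c : 'I_n) (M S : {set 'I_n}) (P : {set {set 'I_n}}).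

Lemma unmixed_card M1 M2 :
  associated_prime (edge_ideal D K) (var_ideal (K := K) (~: M1)) ->
  associated_prime (edge_ideal D K) (var_ideal (K := K) (~: M2)) ->
  #|M1| = #|M2|.
Proof.
move=> as1 as2; apply/eqP.
have /(same_height_var_ideal (frefl _) (frefl _)) eqC := D_unmixed as1 as2.
by rewrite -(eqn_add2r #|~: M1|) cardsC [in X in _ == X]eqC cardsC.
Qed.

Lemma unmixed_well_covered : well_covered (adj D) setT.
Proof.
move=> M1 M2 /(maximal_independent_associated K) as1 max2.
exact: unmixed_card as1 (maximal_independent_associated K max2).
Qed.

(** For [c] in [N(b)] outside [N+(a)], property (P) gives an arc from [c] to [a]. A maximal
    independent set containing [c] and avoiding [N+(a)] has a strong complement, [a] accounting for
    [N+(a)]; but it misses both [b] and [b'], so it is too small. *)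
Lemma unmixed_weight P :
  perfect_matching D P -> property_P D P ->
  forall a b b', (1 < weight D a)%N -> b' \in out_nbhd D a -> [set b; b'] \in P ->
    nbhd D b \subset out_nbhd D a.
Proof.
move=> Pperf Pprop a b b' wa; rewrite inE => ab' bb'.
apply/subsetP => c; rewrite in_nbhdE inE => bc; apply: contraT => nac.
have ca : arc D c a.
  have : adj D c a.
    apply: (Pprop _ _ _ _ _ _ bb'); first by rewrite edgesE -adjE adj_sym.
    by rewrite edgesE ab'.
  by rewrite adjE (negPf nac) orbF.
have [||M Mmax cM] := @maximal_independent_exists _ (adj D) (~: out_nbhd D a) [set c].
- by rewrite sub1set !inE.
- by apply/independentP => x y /set1P-> /set1P->; rewrite adj_irr.
rewrite sub1set in cM.
have [MW iM Mdom] := maximal_independentP (@adj_sym _ D) _ _ Mmax.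
have notin x y : x \in M -> adj D x y -> y \notin M.
  by move=> xM xy; apply/negP => yM; have := independentP _ _ iM x y xM yM; rewrite xy.
have outM x : arc D a x -> x \notin M.
  by move=> ax; apply/negP => /(subsetP MW); rewrite !inE ax.
have as1 : associated_prime (edge_ideal D K) (var_ideal (K := K) (~: M)).
  apply: strong_cover_associated => // x xM.
  have [ax|nax] := boolP (arc D a x).
    right; exists a; split=> //; first by apply: (notin c); rewrite ?adjE ?ca.
    by apply/negP => /out_meetsP[z zM /outM /negP].
  by left; apply: Mdom; rewrite ?inE ?adj_irr.
have [||M' M'max _] := @maximal_independent_exists _ (adj D) setT set0.
- exact: sub0set.
- by apply/independentP => x y; rewrite inE.
have := unmixed_card as1 (maximal_independent_associated K M'max).
rewrite (card_maximal_independent Pperf Pprop M'max) => eqc.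
have := card_independent_missing Pperf iM bb' _ (outM b' ab').
by rewrite eqc ltnn => -> //; apply: notin cM _; rewrite adj_sym.
Qed.

Hypothesis no_isolated : forall x, ~~ isolated D x.
Hypothesis no_cycle3 : ~ has_cycle D 3.
Hypothesis no_cycle5 : ~ has_cycle D 5.
Hypothesis no_cycle7 : ~ has_cycle D 7.

Lemma unmixed_matching : exists P, perfect_matching D P /\ property_P D P.
Proof.
have adjs := @adj_sym _ D; have adji := @adj_irr _ D.
have cyc3 (c : seq 'I_n) : size c = 3 -> ~ ucycle (adj D) c.
  by move=> sz uc; apply: no_cycle3; exists c.
have cyc5 (c : seq 'I_n) : size c = 5 -> ~ ucycle (adj D) c.
  by move=> sz uc; apply: no_cycle5; exists c.
have cyc7 (c : seq 'I_n) : size c = 7 -> ~ ucycle (adj D) c.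
  by move=> sz uc; apply: no_cycle7; exists c.
have walk3 := no_closed_walk3 adjs adji cyc3.
have walk5 := no_closed_walk5 adjs adji cyc3 cyc5.
have walk7 := no_closed_walk7 adjs adji cyc3 cyc5 cyc7.
have [|f [fP cardM]] := well_covered_matching adjs walk3 walk5 walk7 unmixed_well_covered.
  move=> x _; have /set0Pn[y] := no_isolated x; rewrite in_nbhdE => xy.
  by apply/set0Pn; exists y; rewrite !inE.
have fK : involutive f by move=> x; have [] := fP x (in_setT x).
have fadj x : adj D x (f x) by have [] := fP x (in_setT x).
pose P := [set [set x; f x] | x in [set: 'I_n]].
have inP b b' : [set b; b'] \in P -> b' = f b.
  case/imsetP => x _ eqs.
  have neq : b != b'.
    apply/eqP => bb'; move: eqs; rewrite bb' setUid => /setP eqs.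
    have := eqs x; have := eqs (f x); rewrite !inE !eqxx orbT => /eqP fxb /eqP xb.
    by have := fadj x; rewrite fxb xb adji.
  have : b \in [set x; f x] by rewrite -eqs set21.
  have : b' \in [set x; f x] by rewrite -eqs set22.
  by rewrite !inE => /orP[]/eqP b'E /orP[]/eqP bE;
    first [by rewrite b'E bE ?fK | by rewrite b'E bE eqxx in neq].
exists P; split; first split.
- apply/subsetP => B /imsetP[x _ ->]; rewrite edgesE -adjE; exact: fadj.
- apply/trivIsetP => A B /imsetP[x _ ->] /imsetP[y _ ->].
  apply: contraR; case/pred0Pn => z; rewrite !inE => /andP[/orP[]/eqP-> /orP[]/eqP].
  + by move->.
  + by move->; rewrite fK setUC.
  + by move<-; rewrite fK setUC.
  + by move/(can_inj fK)->.
- apply/setP => x; rewrite inE; apply/bigcupP; exists [set x; f x]; last by rewrite set21.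
  by apply: imset_f; rewrite inE.
move=> a a' b b'; rewrite !edgesE -!adjE => ab a'b' /inP b'E; apply: contraT => naa'.
have iaa' : independent (adj D) [set a; a'].
  apply: independentU => //; first by apply/independentP => x y /set1P-> /set1P->; rewrite adji.
    by apply/independentP => x y /set1P-> /set1P->; rewrite adji.
  by move=> x y /set1P-> /set1P->.
have [|M Mmax] := @maximal_independent_exists _ (adj D) setT _ _ iaa'.
  exact: subsetT.
rewrite subUset !sub1set => /andP[aM a'M].
have [_ /independentP iM _] := maximal_independentP adjs _ _ Mmax.
(* Since [M] has half of the vertices, [M] and its image under [f] partition them: either [b] or its
   partner [b'] is in [M], next to [a] or [a']. *)
have disj : M :&: f @: M = set0.
  apply/setP => x; rewrite !inE; apply/negP => /andP[xM /imsetP[y yM xE]].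
  by have := iM y x yM xM; rewrite xE fadj.
have : b \in M :|: f @: M.
  suff -> : M :|: f @: M = setT by rewrite inE.
  apply/eqP; rewrite eqEcard subsetT cardsU disj cards0 subn0.
  by rewrite (card_imset _ (can_inj fK)) addnn cardM // leqnn.
rewrite inE => /orP[bM|/imsetP[y yM bE]].
  by have := iM a b aM bM; rewrite ab.
have b'y : b' = y by rewrite b'E bE fK.
by have := iM a' y a'M yM; rewrite -b'y a'b'.
Qed.

End Unmixed.

Theorem proposition3p7 (K : fieldType) (n : nat) (D : wograph n)
  (no_isolated : forall x : 'I_n, ~~ isolated D x)
  (weight_source_sink :
     forall x : 'I_n, source D x || sink D x -> weight D x = 1%N)
  (no_cycle3 : ~ has_cycle D 3)
  (no_cycle5 : ~ has_cycle D 5)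
  (no_cycle7 : ~ has_cycle D 7) :
  unmixed (edge_ideal D K) <->
  exists P : {set {set 'I_n}},
    [/\ perfect_matching D P,
        property_P D P
      & forall a b b' : 'I_n,
          (1 < weight D a)%N -> b' \in out_nbhd D a -> [set b; b'] \in P ->
          nbhd D b \subset out_nbhd D a].
Proof.
split=> [unm|[P [Pperf Pprop Pweight]]]; last exact: matching_unmixed Pweight.
have [P [Pperf Pprop]] := unmixed_matching unm no_isolated no_cycle3 no_cycle5 no_cycle7.
by exists P; split=> //; apply: unmixed_weight unm _ _ _.
Qed.
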